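(* Let $A\in\mathbb{R}^{d\times d}$ be symmetric and let $b\in\mathbb{R}^d$ be nonzero, with $b\in\mathrm{Range}(A)$ or $b\notin\mathrm{Range}(A)$. Suppose that no unlucky breakdown occurs in the conjugate residual (CR) iteration on $(A,b)$. Then CR and MINRES, both started at $x_0=0$, generate the same sequence of iterates up to termination: with $g$ the grade of $b$ with respect to $A$, and with $T=g$ if $b\in\mathrm{Range}(A)$ and $T=g-1$ if $b\notin\mathrm{Range}(A)$, one has $x_k^{\mathrm{CR}}=x_k^{\mathrm{MINRES}}$ for all $0\le k\le T$.
   Context: Krylov subspace: $\mathcal{K}_k(A,b)=\mathrm{Span}\{b,Ab,\dots,A^{k-1}b\}$, $k\ge 1$. The grade of $b$ with respect to $A$ is the positive integer $g$ with $\dim\mathcal{K}_k(A,b)=k$ for $k\le g$ and $\dim\mathcal{K}_k(A,b)=g$ for $k>g$. CR iteration (in exact arithmetic): $x_0=0$, $r_0=p_0=b$, and for $k=1,2,\dots$, as long as the denominators are nonzero: $\alpha_{k-1}=\langle r_{k-1},Ar_{k-1}\rangle/\|Ap_{k-1}\|^2$, $x_k=x_{k-1}+\alpha_{k-1}p_{k-1}$, $r_k=r_{k-1}-\alpha_{k-1}Ap_{k-1}$, $\beta_{k-1}=\langle r_k,Ar_k\rangle/\langle r_{k-1},Ar_{k-1}\rangle$, $p_k=r_k+\beta_{k-1}p_{k-1}$. It terminates at iterate $x_g$ if $b\in\mathrm{Range}(A)$ and at iterate $x_{g-1}$ if $b\notin\mathrm{Range}(A)$. MINRES iterates: $x_0=0$,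 and for $k\ge1$ the iterate $x_k$ is a solution of $\min_{x\in\mathcal{K}_k(A,b)}\tfrac12\|b-Ax\|^2$. No unlucky breakdown (for CR): if $A$ is indefinite, then no generated residual $r_{k-1}$ is a zero-curvature direction, i.e. there is no generated nonzero $r_{k-1}\notin\mathrm{Null}(A)$ with $\langle r_{k-1},Ar_{k-1}\rangle=0$. *)

(* Defs.v *)
From HB Require Import structures.
From mathcomp Require Import all_boot all_order all_algebra.
From mathcomp Require Import reals.

Set Implicit Arguments.
Unset Strict Implicit.
Unset Printing Implicit Defensive.

Import Order.TTheory GRing.Theory Num.Theory.
Local Open Scope ring_scope.

(* Euclidean norm, defined from the inner product: the matrix norm of
   MathComp-Analysis is the max norm. *)
Definition dotv (R : realType) (d : nat) (u v : 'cV[R]_d) : R := (u^T *m v) 0 0.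

Definition norm2 (R : realType) (d : nat) (v : 'cV[R]_d) : R :=
  Num.sqrt (dotv v v).

Definition mxrange (R : realType) (d : nat) (A : 'M[R]_d) : {vspace 'cV[R]_d} :=
  limg (linfun (mulmx A : 'cV[R]_d -> 'cV[R]_d)).

Definition mxnull (R : realType) (d : nat) (A : 'M[R]_d) : {vspace 'cV[R]_d} :=
  lker (linfun (mulmx A : 'cV[R]_d -> 'cV[R]_d)).

Definition indefinite (R : realType) (d : nat) (A : 'M[R]_d) : Prop :=
  (exists u : 'cV[R]_d, 0 < dotv u (A *m u)) /\
  (exists v : 'cV[R]_d, dotv v (A *m v) < 0).

Definition krylov (R : realType) (d : nat) (A : 'M[R]_d) (b : 'cV[R]_d)
    (k : nat) : {vspace 'cV[R]_d} :=
  <<mkseq (fun i => A ^+ i *m b) k>>%VS.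

Definition is_grade (R : realType) (d : nat) (A : 'M[R]_d) (b : 'cV[R]_d)
    (g : nat) : Prop :=
  [/\ (0 < g)%N,
      forall k : nat, (1 <= k <= g)%N -> \dim (krylov A b k) = k
    & forall k : nat, (g < k)%N -> \dim (krylov A b k) = g].

Record cr_state (R : realType) (d : nat) : Type := CRState {
  cr_x : 'cV[R]_d;
  cr_r : 'cV[R]_d;
  cr_p : 'cV[R]_d
}.

(* One iteration, from index k-1 to index k; [None] when a denominator of
   alpha_(k-1) or beta_(k-1) vanishes. *)
Definition cr_step (R : realType) (d : nat) (A : 'M[R]_d)
    (s : cr_state R d) : option (cr_state R d) :=
  let: CRState x r p := s in
  if (norm2 (A *m p) ^+ 2 == 0) || (dotv r (A *m r) == 0) then None
  else
    let alpha := dotv r (A *m r) / norm2 (A *m p) ^+ 2 in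
    let x' := x + alpha *: p in
    let r' := r - alpha *: (A *m p) in
    let beta := dotv r' (A *m r') / dotv r (A *m r) in
    let p' := r' + beta *: p in
    Some (CRState x' r' p').

(* State of index k; [None] when the iteration has stopped before index k. *)
Definition cr (R : realType) (d : nat) (A : 'M[R]_d) (b : 'cV[R]_d)
    (k : nat) : option (cr_state R d) :=
  iter k (obind (cr_step A)) (Some (CRState 0 b b)).

Definition cr_iterate (R : realType) (d : nat) (A : 'M[R]_d) (b : 'cV[R]_d)
    (k : nat) : option 'cV[R]_d :=
  omap (@cr_x R d) (cr A b k).

Definition cr_residual (R : realType) (d : nat) (A : 'M[R]_d) (b : 'cV[R]_d)
    (k : nat) : option 'cV[R]_d :=
  omap (@cr_r R d) (cr A b k).

Definition no_unlucky_breakdown (R : realType) (d : nat) (A : 'M[R]_d)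
    (b : 'cV[R]_d) : Prop :=
  indefinite A ->
  forall (k : nat) (r : 'cV[R]_d), cr_residual A b k = Some r ->
    ~ [/\ r <> 0, r \notin mxnull A & dotv r (A *m r) = 0].

Definition minres_objective (R : realType) (d : nat) (A : 'M[R]_d)
    (b x : 'cV[R]_d) : R :=
  2^-1 * norm2 (b - A *m x) ^+ 2.

(* The minimizer need not be unique for large k: a MINRES sequence is any
   choice of minimizers. *)
Definition is_minres (R : realType) (d : nat) (A : 'M[R]_d) (b : 'cV[R]_d)
    (x : nat -> 'cV[R]_d) : Prop :=
  x 0%N = 0 /\
  forall k : nat, (1 <= k)%N ->
    x k \in krylov A b k /\
    forall y : 'cV[R]_d, y \in krylov A b k ->
      minres_objective A b (x k) <= minres_objective A b y.

Definition termination_index (R : realType) (d : nat) (A : 'M[R]_d)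
    (b : 'cV[R]_d) (g : nat) : nat :=
  if b \in mxrange A then g else (g - 1)%N.

(* Main.v *)
Require Import Defs.
From HB Require Import structures.
From mathcomp Require Import all_boot all_order all_algebra.
From mathcomp Require Import reals.
From mathcomp Require Import boolp ring lra.

Set Implicit Arguments.
Unset Strict Implicit.
Unset Printing Implicit Defensive.

Import Order.TTheory GRing.Theory Num.Theory.
Local Open Scope ring_scope.

(** Write [K_k] for the Krylov space and [T] for the termination index.

    A point [x] of [K_k] whose residual [b - A x] is orthogonal to [A K_k]
    minimizes the residual norm over [K_k] by Pythagoras, and it is the only
    minimizer when [A] is injective on [K_k] ([normal_eq_minimizer]).  So it
    suffices to show that CR reaches index [k] for all [k <= T], with a residual
    orthogonal to [A K_k], and that [A] is injective on [K_k].

    Injectivity ([krylov_injective_upto_termination]) has two sources.  If [b]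
    is in the range of [A], so is [K_k], and the range of a symmetric matrix
    meets its kernel trivially.  Otherwise [k < g]; since
    [K_(k+1) = <b> + A K_k] has dimension [k+1], the space [A K_k] has the
    dimension [k] of [K_k].

    Orthogonality is an induction on the coupled invariant [cr_invariant]: the
    residual is orthogonal to [A K_k], and so is the image [A p] of the search
    direction.  The coefficient alpha makes the new residual orthogonal to
    [A p], and [A p] together with [A K_k] spans [A K_(k+1)]; beta makes the
    image of the new direction orthogonal to [A p], while its orthogonality to
    [A K_k] needs no coefficient, since [<A r', A y> = <r', A (A y)>] and
    [A y] is in [K_(k+1)] for [y] in [K_k] ([cr_step_invariant]).

    The denominators do not vanish before [T].  A residual with
    [<r, A r> = 0] satisfies [A r = 0]: this is the absence of breakdown when
    [A] is indefinite, and a Cauchy-Schwarz argument when [A] is semidefinite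
    ([zero_curvature_null]).  For [k < T] the residual lies in [K_(k+1)], where
    [A] is injective, so it would vanish, i.e. [b] would lie in [A K_k]; then
    [K_(k+1) = A K_k] would have dimension at most [k].  Finally
    [<r, A p> = <r, A r>], so [A p] is nonzero as well. *)

(** * Inner product *)

Section InnerProduct.
Variables (R : realType) (d : nat).
Implicit Types (u v w : 'cV[R]_d) (A : 'M[R]_d).

Lemma dotvDl u v w : dotv (u + v) w = dotv u w + dotv v w.
Proof. by rewrite /dotv linearD mulmxDl mxE. Qed.

Lemma dotvDr u v w : dotv w (u + v) = dotv w u + dotv w v.
Proof. by rewrite /dotv mulmxDr mxE. Qed.

Lemma dotvZl a u w : dotv (a *: u) w = a * dotv u w.
Proof. by rewrite /dotv linearZ -scalemxAl mxE. Qed.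

Lemma dotvZr a u w : dotv w (a *: u) = a * dotv w u.
Proof. by rewrite /dotv -scalemxAr mxE. Qed.

Lemma dotvNl u w : dotv (- u) w = - dotv u w.
Proof. by rewrite -scaleN1r dotvZl mulN1r. Qed.

Lemma dotvNr u w : dotv w (- u) = - dotv w u.
Proof. by rewrite -scaleN1r dotvZr mulN1r. Qed.

Lemma dotv0r w : dotv w 0 = 0.
Proof. by rewrite /dotv mulmx0 mxE. Qed.

Lemma dotvC u v : dotv u v = dotv v u.
Proof. by rewrite /dotv -[in RHS](trmxK u) -trmx_mul [RHS]mxE. Qed.

Lemma dotv_ge0 u : 0 <= dotv u u.
Proof. by rewrite /dotv mxE sumr_ge0 // => i _; rewrite mxE -expr2 sqr_ge0. Qed.

Lemma dotv_eq0 u : dotv u u = 0 -> u = 0.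
Proof.
rewrite /dotv mxE => /eqP; rewrite psumr_eq0; last first.
  by move=> i _; rewrite mxE -expr2 sqr_ge0.
move=> /allP u0; apply/colP => i; rewrite mxE.
by have := u0 i (mem_index_enum i); rewrite mxE /= mulf_eq0 orbb => /eqP.
Qed.

Lemma norm2_sqr u : norm2 u ^+ 2 = dotv u u.
Proof. by rewrite /norm2 sqr_sqrtr ?dotv_ge0. Qed.

Lemma dotv_sym A u v : A^T = A -> dotv (A *m u) v = dotv u (A *m v).
Proof. by move=> A_sym; rewrite /dotv trmx_mul A_sym mulmxA. Qed.

Lemma psd_zero_curvature_null A u :
    A^T = A -> (forall v, 0 <= dotv v (A *m v)) ->
  dotv u (A *m u) = 0 -> A *m u = 0.
Proof.
move=> A_sym A_psd u0; apply: dotv_eq0.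
set w := A *m u; set n := dotv w w; set c := dotv w (A *m w).
have c_ge0 : 0 <= c by exact: A_psd.
(* These multiples of u and w give the form the value - n^2 (c + 2). *)
have := A_psd ((c + 1) *: u - n *: w).
rewrite !(mulmxDr, mulmxN, =^~ scalemxAr) -/w.
rewrite !(dotvDl, dotvDr, dotvNl, dotvNr, dotvZl, dotvZr) u0.
rewrite -(dotv_sym u w A_sym) -/w -/n -/c => q_ge0.
have : n ^+ 2 <= 0 by nra.
by rewrite real_exprn_even_le0 ?num_real //= => /eqP.
Qed.

End InnerProduct.

(** Without breakdown, zero curvature happens only in the kernel: if [A] is not
    indefinite then [A] or [- A] is positive semidefinite. *)
Lemma zero_curvature_null (R : realType) (d : nat) (A : 'M[R]_d)
    (b r : 'cV[R]_d) (k : nat) :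
    A^T = A -> no_unlucky_breakdown A b -> cr_residual A b k = Some r ->
  dotv r (A *m r) = 0 -> A *m r = 0.
Proof.
move=> A_sym nobd rk r0.
case: (pselect (indefinite A)) => [/nobd/(_ _ _ rk) Nr|NA].
  apply: contra_notP Nr => Ar_neq0; split=> //.
    by move=> rE; apply: Ar_neq0; rewrite rE mulmx0.
  by apply/negP; rewrite memv_ker lfunE /= => /eqP.
case: (pselect (exists u : 'cV[R]_d, 0 < dotv u (A *m u))) => [pos|npos].
  apply: psd_zero_curvature_null r0 => // v; rewrite leNgt; apply/negP => v_lt0.
  by apply: NA; split=> //; exists v.
apply/eqP; rewrite -oppr_eq0 -mulNmx; apply/eqP.
apply: psd_zero_curvature_null => [|v|].
- by rewrite linearN /= A_sym.
- rewrite mulNmx dotvNr oppr_ge0 leNgt; apply/negP => v_gt0.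
  by apply: npos; exists v.
- by rewrite mulNmx dotvNr r0 oppr0.
Qed.

(** * Krylov spaces *)

Section Krylov.
Variables (R : realType) (d : nat) (A : 'M[R]_d) (b : 'cV[R]_d).
Let f := linfun (mulmx A : 'cV[R]_d -> 'cV[R]_d).

Lemma krylovSr k : krylov A b k.+1 = (krylov A b k + <[A ^+ k *m b]>)%VS.
Proof. by rewrite /krylov mkseqS -cats1 span_cat span_seq1. Qed.

Lemma krylovSl k : krylov A b k.+1 = (<[b]> + f @: krylov A b k)%VS.
Proof.
rewrite limg_span /krylov /mkseq /= expr0 mul1mx span_cons; congr (_ + <<_>>)%VS.
rewrite (iotaDl 1 0) -!map_comp; apply: eq_map => i /=.
by rewrite add1n exprS lfunE /= mulmxA.
Qed.

Lemma krylov_sub k y : y \in krylov A b k -> y \in krylov A b k.+1.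
Proof. by apply/subvP; rewrite krylovSr addvSl. Qed.

Lemma krylov_mul k y : y \in krylov A b k -> A *m y \in krylov A b k.+1.
Proof.
move=> yK; rewrite krylovSl; apply: (subvP (addvSr _ _)).
by have := memv_img f yK; rewrite lfunE.
Qed.

Lemma krylov_residual k x :
  x \in krylov A b k -> b - A *m x \in krylov A b k.+1.
Proof.
move=> xK; rewrite memvB ?krylov_mul // krylovSl.
by apply: (subvP (addvSl _ _)); exact: memv_line.
Qed.

(** Consecutive Krylov spaces differ by one line at most, so any new vector
    fills the gap. *)
Lemma krylov_extend k p y :
    p \in krylov A b k.+1 -> p \notin krylov A b k ->
    y \in krylov A b k.+1 ->
  exists2 z, z \in krylov A b k & exists a, y = z + a *: p.
Proof.
rewrite krylovSr => /memv_addP[u uK [_ /vlineP[c ->] pE]] pNK.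
have c_neq0 : c != 0.
  by apply: contraNneq pNK => c0; rewrite pE c0 scale0r addr0.
move=> /memv_addP[v vK [_ /vlineP[e ->] ->]].
exists (v - (e / c) *: u); first by rewrite memvB ?memvZ.
exists (e / c); rewrite pE scalerDr scalerA divfK // addrA.
by rewrite subrK.
Qed.

Lemma krylov_injective_range k y :
    A^T = A -> b \in mxrange A -> y \in krylov A b k -> A *m y = 0 -> y = 0.
Proof.
move=> A_sym bA yK Ay0; apply: dotv_eq0.
have /memv_imgP[z _] : y \in mxrange A.
  apply: (subvP _ _ yK); case: k {yK} => [|k].
    by rewrite /krylov span_nil sub0v.
  rewrite krylovSl subv_add -memvE bA /=.
  exact: limgS (subvf _).
by rewrite lfunE /= => yE; rewrite {1}yE dotv_sym // Ay0 dotv0r.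
Qed.

Lemma dim_krylov_le k : (\dim (krylov A b k) <= k)%N.
Proof. by apply: leq_trans (dim_span _) _; rewrite size_mkseq. Qed.

Lemma krylov_injective_dim k y :
    \dim (krylov A b k.+1) = k.+1 -> y \in krylov A b k ->
  A *m y = 0 -> y = 0.
Proof.
move=> dimK yK Ay0; apply/eqP; rewrite -memv0.
suff /eqP <- : (krylov A b k :&: lker f)%VS == 0%VS.
  by rewrite memv_cap yK memv_ker lfunE /= Ay0.
rewrite -dimv_eq0 -leqn0 -(leq_add2r (\dim (f @: krylov A b k))) limg_ker_dim.
rewrite add0n (leq_trans (dim_krylov_le k)) //.
have := dimv_add_leqif <[b]>%VS (f @: krylov A b k)%VS => -[+ _].
rewrite -krylovSl dimK dim_vline => dim_le.
by rewrite -ltnS -[X in (_ < X)%N]add1n (leq_trans dim_le) // leq_add2r leq_b1.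
Qed.

Lemma krylov_residual_neq0 k x :
    \dim (krylov A b k.+1) = k.+1 -> x \in krylov A b k -> b - A *m x <> 0.
Proof.
move=> dimK xK /eqP; rewrite subr_eq0 => /eqP bE.
have : (krylov A b k.+1 <= f @: krylov A b k)%VS.
  rewrite krylovSl subv_add subvv andbT -memvE {1}bE.
  by have := memv_img f xK; rewrite lfunE.
move=> /dimvS; rewrite dimK leqNgt ltnS => /negP[].
rewrite (leq_trans _ (dim_krylov_le k)) //.
by rewrite -(limg_ker_dim f (krylov A b k)) leq_addl.
Qed.

(** When [b] is outside the range, the termination index is one less than the
    grade, so that [K_(k+1)] still has its full dimension [k+1]. *)
Lemma krylov_injective_upto_termination g k y :
    A^T = A -> is_grade A b g -> (k <= termination_index A b g)%N ->
    y \in krylov A b k -> A *m y = 0 -> y = 0.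
Proof.
move=> A_sym [g_gt0 dimK _]; rewrite /termination_index.
case: ifP => [bA _|_ k_le]; first exact: krylov_injective_range.
by apply: krylov_injective_dim; apply: dimK; rewrite -(prednK g_gt0) ltnS -subn1.
Qed.

(** * The least-squares problem *)

(** Pythagoras: the normal equations [b - A x _|_ A K_k] give
    [|b - A z|^2 = |b - A x|^2 + |A (x - z)|^2] for [z] in [K_k]. *)
Lemma normal_eq_minimizer k x z :
    (forall y, y \in krylov A b k -> A *m y = 0 -> y = 0) ->
    x \in krylov A b k ->
    (forall y, y \in krylov A b k -> dotv (b - A *m x) (A *m y) = 0) ->
    z \in krylov A b k ->
    minres_objective A b z <= minres_objective A b x ->
  x = z.
Proof.
move=> A_inj xK x_orth zK; rewrite ler_pM2l ?invr_gt0 ?ltr0n // !norm2_sqr.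
have -> : b - A *m z = (b - A *m x) + A *m (x - z).
  by rewrite mulmxBr addrA subrK.
have xzK : x - z \in krylov A b k by rewrite memvB.
move: (b - _) x_orth => r x_orth.
rewrite dotvDl !dotvDr [dotv (A *m _) r]dotvC x_orth // => le_zx.
apply/eqP; rewrite -subr_eq0; apply/eqP/A_inj => //; apply: dotv_eq0.
by apply/le_anti; rewrite dotv_ge0 andbT; lra.
Qed.

(** * Conjugate residuals *)

Record cr_invariant (k : nat) (s : cr_state R d) : Prop := CRInvariant {
  cr_inv_x : cr_x s \in krylov A b k;
  cr_inv_r : cr_r s = b - A *m cr_x s;
  cr_inv_p : cr_p s \in krylov A b k.+1;
  cr_inv_r_orth : forall y, y \in krylov A b k -> dotv (cr_r s) (A *m y) = 0;
  cr_inv_p_orth :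
    forall y, y \in krylov A b k -> dotv (A *m cr_p s) (A *m y) = 0;
  cr_inv_rp : dotv (cr_r s) (A *m cr_p s) = dotv (cr_r s) (A *m cr_r s)
}.

Lemma cr_invariant0 : cr_invariant 0 (CRState 0 b b).
Proof.
have K0 y : y \in krylov A b 0 -> y = 0.
  by rewrite /krylov span_nil memv0 => /eqP.
split=> //=; first exact: mem0v; first by rewrite mulmx0 subr0.
- by rewrite -[b in b \in _]subr0 -(mulmx0 _ A) krylov_residual ?mem0v.
- by move=> y /K0 ->; rewrite mulmx0 dotv0r.
- by move=> y /K0 ->; rewrite mulmx0 dotv0r.
Qed.

Lemma cr_step_invariant k s :
    A^T = A -> cr_invariant k s -> dotv (cr_r s) (A *m cr_r s) <> 0 ->
  exists2 s', cr_step A s = Some s' & cr_invariant k.+1 s'.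
Proof.
case: s => x r p A_sym [/= xK rE pK r_orth p_orth rp] /eqP rAr_neq0.
have Ap_neq0 : dotv (A *m p) (A *m p) != 0.
  apply: contra_neq rAr_neq0 => /dotv_eq0 Ap0.
  by rewrite -rp Ap0 dotv0r.
rewrite /cr_step norm2_sqr (negPf Ap_neq0) (negPf rAr_neq0) /=.
set alpha := _ / dotv (A *m p) _; set r' := r - _; set beta := dotv r' _ / _.
eexists; first by [].
have rK : r \in krylov A b k.+1 by rewrite rE krylov_residual.
have x'K : x + alpha *: p \in krylov A b k.+1.
  by rewrite memvD ?(memvZ, pK) // krylov_sub.
have r'E : r' = b - A *m (x + alpha *: p).
  by rewrite mulmxDr -scalemxAr opprD addrA -rE.
have alpha_neq0 : alpha != 0 by rewrite mulf_neq0 ?invr_neq0.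
have pNK : p \notin krylov A b k.
  by apply: contra_neqN Ap_neq0 => /p_orth.
have r'_orth y : y \in krylov A b k.+1 -> dotv r' (A *m y) = 0.
  move=> /(krylov_extend pK pNK)[z zK [a ->]].
  rewrite mulmxDr -scalemxAr dotvDr dotvZr /r' !dotvDl !dotvNl !dotvZl.
  rewrite r_orth // p_orth // rp /alpha divfK //; ring.
have r'K : r' \in krylov A b k.+2 by rewrite r'E krylov_residual.
have ApE : A *m p = alpha^-1 *: (r - r').
  by rewrite /r' opprB addrC subrK scalerA mulVf // scale1r.
clearbody r'.
split=> //=.
- by rewrite memvD ?memvZ // krylov_sub.
- move=> y /(krylov_extend pK pNK)[z zK [a ->]].
  rewrite !mulmxDr -!scalemxAr !(dotvDl, dotvDr, dotvZl, dotvZr).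
  rewrite p_orth // (dotv_sym _ _ A_sym) r'_orth ?krylov_mul //.
  suff -> : dotv (A *m r') (A *m p) = - (beta * dotv (A *m p) (A *m p)) by ring.
  (* In <A r', A p>, replace A p by a multiple of r - r'; the term
     <A r', r> = <r', A r> vanishes since r is in the Krylov space of index
     k + 1. *)
  rewrite {1}ApE dotvZr dotvDr dotvNr (dotv_sym r' r A_sym) r'_orth // add0r.
  rewrite (dotv_sym r' r' A_sym) /beta /alpha; field.
  by rewrite rAr_neq0 Ap_neq0.
- by rewrite mulmxDr -scalemxAr dotvDr dotvZr (r'_orth p) // mulr0 addr0.
Qed.

Lemma cr_upto_termination g k :
    A^T = A -> no_unlucky_breakdown A b -> is_grade A b g ->
    (k <= termination_index A b g)%N ->
  exists2 s, cr A b k = Some s & cr_invariant k s.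
Proof.
move=> A_sym nobd gP; elim: k => [_|k IHk k_lt].
  by exists (CRState 0 b b) => //; exact: cr_invariant0.
have [s crk inv_s] := IHk (ltnW k_lt).
suff r_neq0 : dotv (cr_r s) (A *m cr_r s) <> 0.
  have [s' stepE inv_s'] := cr_step_invariant A_sym inv_s r_neq0.
  by exists s' => //; rewrite /cr iterS -/(cr A b k) crk.
have crr : cr_residual A b k = Some (cr_r s) by rewrite /cr_residual crk.
move=> /(zero_curvature_null A_sym nobd crr).
have xK := cr_inv_x inv_s; rewrite (cr_inv_r inv_s).
move=> /(krylov_injective_upto_termination A_sym gP k_lt (krylov_residual xK)).
apply: krylov_residual_neq0 xK; case: gP => _ dimK _; apply: dimK.
apply: leq_trans k_lt _; rewrite /termination_index.
by case: ifP => _; rewrite ?leq_subr.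
Qed.

End Krylov.

Theorem theorem5 (R : realType) (d : nat) (A : 'M[R]_d) (b : 'cV[R]_d)
  (g : nat) (x_minres : nat -> 'cV[R]_d)
  (A_sym : A^T = A) (b_neq0 : b <> 0)
  (no_breakdown : no_unlucky_breakdown A b)
  (g_grade : is_grade A b g)
  (x_minresP : is_minres A b x_minres) :
  forall k : nat, (k <= termination_index A b g)%N ->
    cr_iterate A b k = Some (x_minres k).
Proof.
move=> k k_le; case: x_minresP => x0 xP.
case: k k_le => [_|k k_le]; first by rewrite x0.
have [s crk inv_s] := cr_upto_termination A_sym no_breakdown g_grade k_le.
rewrite /cr_iterate crk /=; congr Some; have [xK x_min] := xP k.+1 isT.
apply: normal_eq_minimizer xK (x_min _ (cr_inv_x inv_s)).
- by move=> y; exact: krylov_injective_upto_termination A_sym g_grade k_le.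
- exact: cr_inv_x inv_s.
- by move=> y; rewrite -(cr_inv_r inv_s); exact: cr_inv_r_orth inv_s y.
Qed.
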